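(* Let $\mathcal{X}=\{x_1,\dots,x_m\}$ be a finite alphabet, let $n_0\ge 1$ and let $\nu^{n_0}$ be an $n_0$-type on $\mathcal{X}$. Let $\mathcal{Q}\subseteq\mathcal{P}(\mathcal{X})$ be an open set of sources. Assume the uniform prior on $n$-sources for each $n$. Then, as $n\to\infty$ along the subsequence $n=kn_0$, $k\in\mathbb{N}$, with $\nu^n=\nu^{kn_0}$ the type $k$-equivalent to $\nu^{n_0}$, $$\lim_{k\to\infty,\ n=kn_0}\ \frac1n\log\pi(q^n\in\mathcal{Q}\mid\nu^n)=L(\mathcal{Q}\,\|\,\nu^{n_0})-L(\mathcal{P}(\mathcal{X})\,\|\,\nu^{n_0}).$$
   Context: $\mathcal{P}(\mathcal{X})$ is the set of all probability mass functions (pmf's) on $\mathcal{X}$, with the topology induced from $\mathbb{R}^m$; its elements are called sources. $\mathcal{R}_n$ is the set of $n$-rational pmf's, i.e. those of the form $[n_1,\dots,n_m]/n$ with nonnegative integers $n_i$ summing to $n$. Elements of $\mathcal{R}_n$ are called $n$-types (when regarded as empirical measures of sequences of length $n$) or $n$-sources (when regarded as sources, written $q^n$). If $\nu^{n_0}=[n_1,\dots,n_m]/n_0$, the type $k$-equivalent to it is $\nu^{kn_0}=[kn_1,\dots,kn_m]/(kn_0)$, which is the same pmf. Uniform prior: $\pi(q^n)=1/N$ for all $q^n\in\mathcal{R}_n$, where $N=\binom{n+m-1}{m-1}=|\mathcal{R}_n|$. Likelihood: $\pi(\nu^n\mid q^n)=\Gamma(\nu^n)\prod_{i=1}^m(q^n_i)^{n\nu^n_i}$,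 with $\Gamma(\nu^n)=n!/\prod_{i=1}^m n_i!$ for $\nu^n=[n_1,\dots,n_m]/n$ (convention $0^0=1$). The posterior is given by Bayes' theorem: $\pi(q^n\mid\nu^n)=\pi(\nu^n\mid q^n)\pi(q^n)/\sum_{\tilde q\in\mathcal{R}_n}\pi(\nu^n\mid\tilde q)\pi(\tilde q)$, and $\pi(q^n\in\mathcal{Q}\mid\nu^n)=\sum_{q^n\in\mathcal{Q}\cap\mathcal{R}_n}\pi(q^n\mid\nu^n)$. For $p,q\in\mathcal{P}(\mathcal{X})$ the $L$-divergence is $L(q\|p)=\sum_{x\in\mathcal{X}}p(x)\log q(x)\in\mathbb{R}\cup\{-\infty\}$ (conventions $\log 0=-\infty$, $0\log 0=0$), and for a set $\mathcal{C}$ of sources $L(\mathcal{C}\|p)=\sup_{q\in\mathcal{C}}L(q\|p)$. *)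

(* Defs.v *)
From HB Require Import structures.
From mathcomp Require Import all_boot all_order all_algebra.
From mathcomp Require Import all_classical all_reals all_analysis.
Set Implicit Arguments.
Unset Strict Implicit.
Unset Printing Implicit Defensive.
Import Order.TTheory GRing.Theory Num.Theory.
Import numFieldNormedType.Exports.
Local Open Scope classical_set_scope.
Local Open Scope ring_scope.

(* The alphabet {x_1, ..., x_m} is indexed by 'I_m, so that a function on it is
   a row vector and R^m carries the topology of 'rV[R]_m. *)
Definition pmfs (R : realType) (m : nat) : set 'rV[R]_m :=
  [set q | (forall i, 0 <= q 0 i) /\ \sum_(i < m) q 0 i = 1].
Arguments pmfs : clear implicits.

(* Open in the topology that pmfs R m inherits from R^m.  In [subspace A] the
   points outside A are isolated, hence the inclusion. *)
Definition open_sources (R : realType) (m : nat) (Q : set 'rV[R]_m) : Prop :=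
  Q `<=` pmfs R m /\ open (Q : set (subspace (pmfs R m))).

(* An n-type [n_1, ..., n_m] / n is given by its counts n_1, ..., n_m. *)
Definition is_type (m n : nat) (c : 'I_m -> nat) : Prop :=
  (\sum_(i < m) c i)%N = n.

Definition type_pmf (R : realType) (m n : nat) (c : 'I_m -> nat) : 'rV[R]_m :=
  \row_i ((c i)%:R / n%:R).

Definition type_equiv (m k : nat) (c : 'I_m -> nat) : 'I_m -> nat :=
  fun i => (k * c i)%N.

(* The n-rational pmfs.  Only n > 0 is meaningful: for n = 0 the set is {0}. *)
Definition nsources (R : realType) (m n : nat) : set 'rV[R]_m :=
  [set type_pmf R n c | c in [set c : 'I_m -> nat | is_type n c]].
Arguments nsources : clear implicits.

Definition uniform_prior (R : realType) (m n : nat) (q : 'rV[R]_m) : R :=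
  \1_(nsources R m n) q / 'C(n + m - 1, m - 1)%:R.

Definition multinom_coef (R : realType) (m n : nat) (c : 'I_m -> nat) : R :=
  n`!%:R / \prod_(i < m) (c i)`!%:R.

(* For nu = type_pmf R n c the exponent n * nu_i is the count c i. *)
Definition likelihood (R : realType) (m n : nat) (c : 'I_m -> nat)
    (q : 'rV[R]_m) : R :=
  multinom_coef R n c * \prod_(i < m) q 0 i ^+ c i.

(* The sums over sets of n-sources below have finite support; see
   [finite_nsources]. *)
Definition posterior (R : realType) (m n : nat) (c : 'I_m -> nat)
    (q : 'rV[R]_m) : R :=
  likelihood n c q * uniform_prior n q
  / \sum_(q' \in nsources R m n) (likelihood n c q' * uniform_prior n q').

Definition posterior_set (R : realType) (m n : nat) (c : 'I_m -> nat)
    (Q : set 'rV[R]_m) : R :=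
  \sum_(q \in Q `&` nsources R m n) posterior n c q.

(* [lne 0 = -oo] and [0 * -oo = 0] in the extended reals.  On pmfs every
   summand is at most 0, so that +oo and -oo are never added. *)
Definition Ldiv (R : realType) (m : nat) (q p : 'rV[R]_m) : \bar R :=
  (\sum_(i < m) (p 0%R i)%:E * lne (q 0%R i)%:E)%E.

Definition Ldiv_set (R : realType) (m : nat) (C : set 'rV[R]_m)
    (p : 'rV[R]_m) : \bar R :=
  ereal_sup [set Ldiv q p | q in C].

Lemma finite_nsources (R : realType) (m n : nat) :
  finite_set (nsources R m n).
Proof.
pose g (t : {ffun 'I_m -> 'I_n.+1}) := type_pmf R n (fun i => t i : nat).
apply: (@sub_finite_set _ _ (g @` setT)); last first.
  by apply: finite_image; exact: finite_finset.
move=> _ [c cn <-]; exists [ffun i => inord (c i)] => //.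
apply/rowP => i; rewrite !mxE ffunE inordK// ltnS -cn.
by rewrite (bigD1 i)//= leq_addr.
Qed.

Lemma nsources_pmfs (R : realType) (m n : nat) :
  (0 < n)%N -> nsources R m n `<=` pmfs R m.
Proof.
move=> n0 _ [c cn <-]; split=> [i|]; first by rewrite mxE divr_ge0.
under eq_bigr do rewrite mxE.
by rewrite -mulr_suml -natr_sum cn divff// pnatr_eq0 -lt0n.
Qed.

(* Main.v *)
Require Import Defs.
From HB Require Import structures.
From mathcomp Require Import all_boot all_order all_algebra.
From mathcomp Require Import all_classical all_reals all_analysis.
From mathcomp Require Import lra.
Import Order.TTheory GRing.Theory Num.Theory.
Import numFieldNormedType.Exports.
Local Open Scope classical_set_scope.
Local Open Scope ring_scope.

(** Write w(q) for the product of the q_i^(c_i), where c are the counts of the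
    type nu of length n0.  Then L(q || nu) = ln (w q) / n0, with w q = 0
    corresponding to -oo, and the k-equivalent type of length n = k n0 has
    likelihood w(q)^k up to a factor that does not depend on q.  This factor and
    the uniform prior cancel in Bayes' formula, so the posterior of Q is the
    ratio S_k(Q) / S_k(P) of sums of w^k over the n-sources in Q and over all
    n-sources ([posterior_setE]).

    For every relatively open set Q with finite L(Q || nu), Laplace's principle
    gives ln (S_k(Q)) / n --> L(Q || nu) ([cvg_ln_weight_sum]).  From above,
    S_k(Q) has at most (n + 1)^m terms, each at most exp (n L(Q || nu)), and
    ln ((n + 1)^m) is negligible against n ([weight_sum_le],
    [ln_expn_succ_le]).  From below, if a < L(Q || nu), then a < L(q || nu) for
    some q in Q; as w is continuous and Q is open, this persists near q, where
    n-sources are found once n is large ([nsources_dense]), and a single one of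
    them contributes at least exp (n a) ([weight_sum_ge]).

    The full simplex is itself relatively open, and its L-divergence is finite
    since w(nu) > 0.  Applied to Q and to the simplex, the principle gives the
    limit as a difference.  If L(Q || nu) = -oo, for instance when Q is empty,
    then w vanishes on Q and both sides are -oo. *)

(** * The L-divergence as a normalized log-likelihood *)

Definition weight {R : realType} {m : nat} (c : 'I_m -> nat) (q : 'rV[R]_m)
    : R :=
  \prod_(i < m) q 0 i ^+ c i.

Definition weight_sum {R : realType} {m : nat} (n k : nat) (c : 'I_m -> nat)
    (Q : set 'rV[R]_m) : R :=
  \sum_(q \in Q `&` nsources R m n) weight c q ^+ k.

Lemma weight_ge0 {R : realType} {m : nat} (c : 'I_m -> nat) {q : 'rV[R]_m} :
  (forall i, 0 <= q 0 i) -> 0 <= weight c q.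
Proof. by move=> q0; apply: prodr_ge0 => i _; rewrite exprn_ge0. Qed.

Lemma weight_le1 {R : realType} {m : nat} (c : 'I_m -> nat) {q : 'rV[R]_m} :
  pmfs R m q -> weight c q <= 1.
Proof.
move=> [q0 q1]; apply: prodr_ile1 => i _; rewrite exprn_ge0//= exprn_ile1//.
by rewrite -q1 (bigD1 i)//= lerDl sumr_ge0.
Qed.

Lemma continuous_weight {R : realType} {m : nat} (c : 'I_m -> nat) :
  continuous (@weight R m c).
Proof.
move=> q; apply: (@cvg_big _ _ _ _ xpredT _ _ (nbhs q) (index_enum 'I_m)
  (fun i (x : 'rV[R]_m) => x 0 i ^+ c i)).
  exact: mul_continuous.
move=> i _.
apply: (@continuous_comp _ _ _ (fun x : 'rV[R]_m => x 0 i) (fun y => y ^+ c i)).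
  exact: coord_continuous.
exact: exprn_continuous.
Qed.

Lemma ln_weight {R : realType} {m : nat} (c : 'I_m -> nat) {q : 'rV[R]_m} :
  (forall i, 0 <= q 0 i) -> 0 < weight c q ->
  ln (weight c q) = \sum_(i < m) (c i)%:R * ln (q 0 i).
Proof.
move=> q0 w0.
have qc0 i : 0 < q 0 i ^+ c i.
  rewrite lt_neqAle exprn_ge0// andbT eq_sym.
  apply: contraTN w0 => /eqP qi.
  by rewrite /weight (bigD1 i)//= qi mul0r ltxx.
suff [] : 0 < weight c q /\
          ln (weight c q) = \sum_(i < m) (c i)%:R * ln (q 0 i) by [].
rewrite /weight; apply: (big_ind2 (fun x y => 0 < x /\ ln x = y)).
- by rewrite ln1.
- by move=> x y x' y' [x0 <-] [x'0 <-]; rewrite mulr_gt0// lnM// posrE.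
- move=> i _; split=> //; have := qc0 i.
  case: (c i) => [|d]; first by rewrite expr0 ln1 mul0r.
  move=> qd; rewrite lnXn ?mulr_natl// lt_neqAle q0 andbT eq_sym.
  by apply: contraTN qd => /eqP->; rewrite exprS mul0r ltxx.
Qed.

Lemma Ldiv_weight_gt0 {R : realType} {m n0 : nat} (c : 'I_m -> nat)
    {q : 'rV[R]_m} :
  (forall i, 0 <= q 0 i) -> 0 < weight c q ->
  Ldiv q (type_pmf R n0 c) = (ln (weight c q) / n0%:R)%:E.
Proof.
move=> q0 w0; rewrite ln_weight// mulr_suml -sumEFin /Ldiv.
apply: eq_bigr => i _; rewrite mxE.
have := w0; rewrite /weight (bigD1 i)//=.
have [qi _|qi] := ltP 0 (q 0 i).
  by rewrite -EFinM mulrAC.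
have -> : q 0 i = 0 by apply/eqP; rewrite eq_le qi q0.
case: (c i) => [_|d]; first by rewrite !mul0r mul0e.
by rewrite exprS !mul0r ltxx.
Qed.

Lemma Ldiv_weight_eq0 {R : realType} {m n0 : nat} (c : 'I_m -> nat)
    {q : 'rV[R]_m} :
  (0 < n0)%N -> weight c q = 0 -> Ldiv q (type_pmf R n0 c) = -oo%E.
Proof.
move=> n0_gt0 /eqP /prodf_eq0[i _]; rewrite expf_eq0 => /andP[ci /eqP qi].
apply/eqP; rewrite esum_eqNy; apply/existsP; exists i; apply/eqP.
by rewrite mxE qi le0_lneNy// gt0_muleNy// lte_fin divr_gt0// ltr0n.
Qed.

(** Both sides are false when w q = 0, so that comparisons of L with reals
    become comparisons of w with positive reals, without a case distinction. *)
Lemma Ldiv_gt {R : realType} {m n0 : nat} (c : 'I_m -> nat) {q : 'rV[R]_m}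
    {a : R} :
  (0 < n0)%N -> (forall i, 0 <= q 0 i) ->
  (a%:E < Ldiv q (type_pmf R n0 c))%E = (expR (n0%:R * a) < weight c q).
Proof.
move=> n0_gt0 q0; have := weight_ge0 c q0; rewrite le_eqVlt => /orP[/eqP w0|w0].
  rewrite Ldiv_weight_eq0// -w0; apply/esym/negbTE.
  by rewrite -leNgt expR_ge0.
rewrite Ldiv_weight_gt0// lte_fin ltr_pdivlMr ?ltr0n// mulrC.
by rewrite -[in RHS](lnK w0) ltr_expR.
Qed.

Lemma Ldiv_le0 {R : realType} {m n0 : nat} (c : 'I_m -> nat) {q : 'rV[R]_m} :
  (0 < n0)%N -> pmfs R m q -> (Ldiv q (type_pmf R n0 c) <= 0)%E.
Proof.
move=> n0_gt0 qP; rewrite leNgt Ldiv_gt// ?mulr0 ?expR0; last by case: qP.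
by rewrite -leNgt weight_le1.
Qed.

Lemma open_sources_pmfs (R : realType) (m : nat) : open_sources (pmfs R m).
Proof.
split=> //; apply/open_subspaceP; exists setT; first exact: openT.
by rewrite setTI setIid.
Qed.

(** * Density and number of n-sources *)

(** Round every n q_i down; the at most m units that are lost are given back to
    the first letter, so that the counts sum to n. *)
Lemma pmf_approx {R : realType} {m n : nat} {q : 'rV[R]_m} :
  pmfs R m q -> (0 < n)%N ->
  exists2 x, nsources R m n x & forall i, `|x 0 i - q 0 i| <= m%:R / n%:R.
Proof.
move=> [q0 q1] n_gt0.
have nR : 0 < n%:R :> R by rewrite ltr0n.
case: m q q0 q1 => [|m] q q0 q1.
  by move: q1; rewrite big_ord0 => /esym/eqP; rewrite oner_eq0.
have nq : \sum_i n%:R * q 0 i = n%:R by rewrite -mulr_sumr q1 mulr1.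
pose f i := Num.truncn (n%:R * q 0 i).
have f_itv i : ((f i)%:R : R) <= n%:R * q 0 i < (f i)%:R + 1.
  by rewrite natr1 truncn_itv// mulr_ge0.
have sumf : (\sum_i f i)%:R <= n%:R :> R.
  rewrite natr_sum -nq; apply: ler_sum => i _.
  by have /andP[] := f_itv i.
have sumf' : n%:R <= (\sum_i f i)%:R + m.+1%:R :> R.
  rewrite natr_sum -[leLHS]nq.
  rewrite -[X in _ + X%:R]card_ord -sumr_const -big_split/=.
  by apply: ler_sum => i _; have /andP[_ /ltW] := f_itv i.
move: sumf; rewrite ler_nat => sumf.
pose r := (n - \sum_i f i)%N.
have rm : r%:R <= m.+1%:R :> R.
  by rewrite ler_nat leq_subLR -(ler_nat R) natrD.
pose t i := (f i + (i == ord0) * r)%N.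
exists (type_pmf R n t).
  exists t => //; rewrite /is_type /t/= big_split/=.
  rewrite [X in (_ + X)%N](bigD1 ord0)//=.
  rewrite mul1n [X in (r + X)%N]big1 => [|i /negPf i0]; last by rewrite i0.
  by rewrite addn0 subnKC.
move=> i; rewrite mxE -(ler_pM2r nR) divfK ?gt_eqF//.
rewrite -[X in _ * X]ger0_norm ?(ltW nR)// -normrM mulrBl divfK ?gt_eqF//.
have /andP[f1 f2] := f_itv i.
have m1 : 1 <= m.+1%:R :> R by rewrite ler1n.
have t1 : (f i)%:R <= (t i)%:R :> R by rewrite /t natrD lerDl.
have t2 : (t i)%:R <= (f i)%:R + m.+1%:R :> R.
  rewrite /t natrD lerD2l; case: (i == ord0); first by rewrite mul1n.
  by rewrite mul0n.
rewrite ler_norml; apply/andP; split; lra.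
Qed.

Lemma nsources_dense {R : realType} {m : nat} {q : 'rV[R]_m}
    {U : set 'rV[R]_m} :
  pmfs R m q -> nbhs q U -> \forall n \near \oo, U `&` nsources R m n !=set0.
Proof.
move=> qP /nbhs_ballP[e/= e0 eU].
near=> n.
have n_gt0 : (0 < n)%N by near: n; exact: nbhs_infty_gt.
have [x xn xq] := pmf_approx qP n_gt0.
exists x; split=> //; apply: eU; split=> // i j; rewrite !ord1 /ball/= distrC.
apply: le_lt_trans (xq j) _.
rewrite ltr_pdivrMr ?ltr0n// mulrC -ltr_pdivrMr//.
near: n; exact: nbhs_infty_gtr.
Unshelve. all: by end_near. Qed.

(** An n-source is given by m counts in {0, ..., n}, hence there are at most
    (n + 1)^m of them; this crude bound is enough on the exponential scale. *)
Lemma nsources_sum_le {R : realType} {m n : nat} {A : set 'rV[R]_m}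
    (f : 'rV[R]_m -> R) (M : R) :
  A `<=` nsources R m n -> (forall q, A q -> f q <= M) -> 0 <= M ->
  \sum_(q \in A) f q <= n.+1%:R ^+ m * M.
Proof.
move=> An fM M0.
have finA : finite_set A by apply: sub_finite_set An (finite_nsources R m n).
pose g (t : {ffun 'I_m -> 'I_n.+1}) := type_pmf R n (fun i => t i : nat).
rewrite fsbig_finite//=.
apply: (@le_trans _ _ (\sum_(q <- finmap.enum_fset (fset_set A)) M)).
  rewrite big_seq [leRHS]big_seq; apply: ler_sum => q.
  by rewrite in_fset_set// inE => /fM.
rewrite big_const_seq count_predT iter_addr addr0.
rewrite -(mulr_natl M) ler_wpM2r// -natrX ler_nat.
have -> : (n.+1 ^ m = size (map g (enum {ffun 'I_m -> 'I_n.+1})))%N.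
  by rewrite size_map -cardE card_ffun !card_ord.
apply: uniq_leq_size => [|q]; first exact: finmap.fset_uniq.
rewrite in_fset_set// inE => /An[t tn <-].
apply/mapP; exists [ffun i => inord (t i)]; first by rewrite mem_enum.
apply/rowP => i; rewrite !mxE ffunE inordK// ltnS -tn.
by rewrite (bigD1 i)//= leq_addr.
Qed.

(** With s the square root of n + 1, ln ((n + 1)^m) = 2 m ln s <= 2 m s, which
    is negligible against n since s^2 <= 2 n. *)
Lemma ln_expn_succ_le {R : realType} (m : nat) {e : R} :
  0 < e -> \forall n \near \oo, ln (n.+1%:R ^+ m : R) <= e * n%:R.
Proof.
move=> e0; near=> n.
have n_gt0 : (0 < n)%N by near: n; exact: nbhs_infty_gt.
pose s := Num.sqrt n.+1%:R : R.
have s0 : 0 < s by rewrite sqrtr_gt0 ltr0n.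
have sE : s ^+ 2 = n.+1%:R by rewrite sqr_sqrtr.
have s2 : s ^+ 2 <= 2 * n%:R.
  by rewrite sE -natr1 mulr_natl mulr2n lerD2l ler1n.
(* For large n: this requires n to exceed the square of 4 m / e. *)
have ms : m%:R * 4 <= e * s.
  rewrite -ler_pdivrMl// -(@ler_pXn2r _ 2)// ?nnegrE ?(ltW s0)//; last first.
    by rewrite mulr_ge0// invr_ge0 ltW.
  rewrite sE (le_trans (y := n%:R))// ?ler_nat//.
  near: n; exact: nbhs_infty_ger.
rewrite -sE -exprM lnXn// -(mulr_natl (ln s)) natrM.
apply: (le_trans (y := 2 * m%:R * s)).
  by rewrite ler_wpM2l ?mulr_ge0// ltW// ln_sublinear.
have : m%:R * 4 * s <= e * s * s by rewrite ler_wpM2r ?(ltW s0).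
have : e * s ^+ 2 <= e * (2 * n%:R) by rewrite ler_wpM2l ?(ltW e0).
rewrite expr2; lra.
Unshelve. all: by end_near. Qed.

(** * Exponential growth rate of the weight sums *)

Lemma weight_sum_le {R : realType} {m n0 : nat} (k : nat) {c : 'I_m -> nat}
    {Q : set 'rV[R]_m} {A : R} :
  (0 < n0)%N -> Q `<=` pmfs R m -> Ldiv_set Q (type_pmf R n0 c) = A%:E ->
  weight_sum (k * n0) k c Q <=
    (k * n0).+1%:R ^+ m * expR ((k * n0)%:R * A).
Proof.
move=> n0_gt0 QP QA; apply: nsources_sum_le; rewrite ?expR_ge0//.
move=> q [Qq _]; have [q0 _] := QP _ Qq.
rewrite natrM -mulrA mulrC expRM_natr lerXn2r ?nnegrE ?expR_ge0 ?weight_ge0//.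
rewrite leNgt -Ldiv_gt// -leNgt -QA; apply: ereal_sup_ubound.
by exists q.
Qed.

(** This is where openness of Q enters: a near-maximizer of L need not be
    n-rational, but the sources near it lie in Q and have nearly the same
    weight. *)
Lemma weight_sum_ge {R : realType} {m n0 : nat} {c : 'I_m -> nat}
    {Q : set 'rV[R]_m} {a : R} :
  (0 < n0)%N -> open_sources Q ->
  (a%:E < Ldiv_set Q (type_pmf R n0 c))%E ->
  \forall k \near \oo,
    expR ((k * n0)%:R * a) <= weight_sum (k * n0) k c Q.
Proof.
move=> n0_gt0 [QP /open_subspaceP[V Vo VQ]] /ereal_sup_gt[_ [q Qq <-]].
have qP := QP _ Qq; rewrite Ldiv_gt//; last by case: qP.
move=> aq.
have : nbhs q (V `&` [set y | expR (n0%:R * a) < weight c y]).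
  apply: filterI.
    apply: open_nbhs_nbhs; split=> //.
    by have [] : (V `&` pmfs R m) q by rewrite VQ.
  exact: (continuous_weight c q _ (lt_nbhsr aq)).
move=> /(nsources_dense qP)[N _ HN].
exists N.+1 => // k /= Nk.
have k_gt0 : (0 < k)%N by apply: leq_trans Nk.
have [|x [[Vx ax] xn]] := HN (k * n0)%N.
  by rewrite /= (leq_trans (ltnW Nk))// leq_pmulr.
have xP : pmfs R m x by apply: nsources_pmfs xn; rewrite muln_gt0 k_gt0.
have Qx : Q x by have [] : (Q `&` pmfs R m) x by rewrite -VQ.
rewrite /weight_sum (fsbigD1 x)//=; last first.
- apply: finite_setI; right; exact: finite_nsources.
rewrite -[leLHS]addr0 lerD//; last first.
  apply: fsumr_ge0 => y [[/QP[y0 _] _] _].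
  by rewrite exprn_ge0 ?weight_ge0.
rewrite natrM -mulrA mulrC expRM_natr lerXn2r ?nnegrE ?expR_ge0//.
  by rewrite weight_ge0//; case: xP.
exact: ltW.
Qed.

(** Laplace's principle for the counting measure on n-sources. *)
Lemma cvg_ln_weight_sum {R : realType} {m n0 : nat} {c : 'I_m -> nat}
    {Q : set 'rV[R]_m} {A : R} :
  (0 < n0)%N -> open_sources Q -> Ldiv_set Q (type_pmf R n0 c) = A%:E ->
  ln (weight_sum (k * n0) k c Q) / (k * n0)%:R @[k --> \oo] --> A.
Proof.
move=> n0_gt0 Qo QA; apply/cvgrPdist_le => e e0; near=> k.
have k_gt0 : (0 < k)%N by near: k; exact: nbhs_infty_gt.
have n_gt0 : 0 < (k * n0)%:R :> R by rewrite ltr0n muln_gt0 k_gt0.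
have lo : expR ((k * n0)%:R * (A - e)) <= weight_sum (k * n0) k c Q.
  near: k; apply: weight_sum_ge => //; rewrite QA lte_fin; lra.
have S0 := lt_le_trans (expR_gt0 _) lo.
have hi := weight_sum_le k n0_gt0 Qo.1 QA.
rewrite distrC ler_distl ler_pdivrMr// ler_pdivlMr//; apply/andP; split.
  by rewrite mulrC -(expRK (_ * _)) ler_ln// posrE ?expR_gt0.
apply: le_trans (_ : ln ((k * n0).+1%:R ^+ m * expR ((k * n0)%:R * A)) <= _).
  by rewrite ler_ln// posrE mulr_gt0 ?expR_gt0 ?exprn_gt0.
rewrite lnM ?posrE ?expR_gt0 ?exprn_gt0// expRK addrC mulrDl [A * _]mulrC.
rewrite lerD2l; near: k.
have [N _ HN] := ln_expn_succ_le m e0.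
exists N.+1 => // k /= Nk; apply: HN.
by rewrite /= (leq_trans (ltnW Nk))// leq_pmulr.
Unshelve. all: by end_near. Qed.

Lemma weight_sum_gt0_near {R : realType} {m n0 : nat} {c : 'I_m -> nat}
    {Q : set 'rV[R]_m} {A : R} :
  (0 < n0)%N -> open_sources Q -> Ldiv_set Q (type_pmf R n0 c) = A%:E ->
  \forall k \near \oo, 0 < weight_sum (k * n0) k c Q.
Proof.
move=> n0_gt0 Qo QA.
have : ((A - 1)%:E < Ldiv_set Q (type_pmf R n0 c))%E by rewrite QA lte_fin; lra.
move=> /(weight_sum_ge n0_gt0 Qo); apply: filterS => k.
exact: lt_le_trans (expR_gt0 _).
Qed.

(** * The limit of the posterior *)

(** The multinomial coefficient, the prior mass and hence their product K are
    the same for all n-sources and cancel.  For n = 0 the only 0-source is the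
    zero vector, which is not a pmf. *)
Lemma posterior_setE {R : realType} {m n0 k : nat} (c : 'I_m -> nat)
    {Q : set 'rV[R]_m} :
  (0 < k * n0)%N ->
  posterior_set (k * n0) (type_equiv k c) Q =
  weight_sum (k * n0) k c Q / weight_sum (k * n0) k c (pmfs R m).
Proof.
set n := (k * n0)%N => n_gt0.
pose K : R := multinom_coef R n (type_equiv k c) / 'C(n + m - 1, m - 1)%:R.
have K0 : K != 0.
  rewrite /K /multinom_coef !mulf_neq0 ?invr_eq0 ?pnatr_eq0 -?lt0n ?fact_gt0//.
    by apply/prodf_neq0 => i _; rewrite pnatr_eq0 -lt0n fact_gt0.
  by rewrite bin_gt0 leq_sub2r// leq_addl.
have lpE q : nsources R m n q ->
    likelihood n (type_equiv k c) q * uniform_prior n q = K * weight c q ^+ k.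
  move=> qn; rewrite /likelihood /uniform_prior indicE mem_set// mul1r.
  rewrite mulrAC; congr (_ * _); rewrite /weight -prodrXl.
  by apply: eq_bigr => i _; rewrite /type_equiv mulnC exprM.
have den : \sum_(q \in nsources R m n)
    (likelihood n (type_equiv k c) q * uniform_prior n q) =
    K * weight_sum n k c (pmfs R m).
  rewrite /weight_sum setIidr; last exact: nsources_pmfs.
  by rewrite mulr_fsumr; apply: eq_fsbigr => q /set_mem /lpE.
rewrite /posterior_set /weight_sum mulr_fsuml.
apply: eq_fsbigr => q /set_mem[_ qn].
by rewrite /posterior den lpE// -mulf_div divff// mul1r.
Qed.

Theorem mainTheorem1 (R : realType) (m n0 : nat) (c : 'I_m -> nat)
    (Q : set 'rV[R]_m) (n0_gt0 : (0 < n0)%N) (c_type : is_type n0 c)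
    (Q_open : open_sources Q) :
  (fun k : nat =>
     ((k * n0)%:R^-1)%:E
     * lne (posterior_set (k * n0) (type_equiv k c) Q)%:E)%E @ \oo
  --> (Ldiv_set Q (type_pmf R n0 c)
       - Ldiv_set (pmfs R m) (type_pmf R n0 c))%E.
Proof.
pose p := type_pmf R n0 c.
have Po := open_sources_pmfs R m.
have pP : pmfs R m p by apply: (@nsources_pmfs _ _ n0) => //; exists c.
have wp : 0 < weight c p.
  apply: prodr_gt0 => i _; rewrite mxE; case: (c i) => [|d].
    by rewrite expr0.
  by rewrite exprn_gt0// divr_gt0// ltr0n.
have Lset_le0 (C : set 'rV[R]_m) : C `<=` pmfs R m -> (Ldiv_set C p <= 0)%E.
  by move=> CP; apply: ge_ereal_sup => _ [q /CP qP <-]; exact: Ldiv_le0.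
have [B PB] : exists B, Ldiv_set (pmfs R m) p = B%:E.
  have := Lset_le0 _ (@subset_refl _ (pmfs R m)).
  have : (Ldiv p p <= Ldiv_set (pmfs R m) p)%E.
    by apply: ereal_sup_ubound; exists p.
  rewrite Ldiv_weight_gt0//; last by case: pP.
  by case: (Ldiv_set _ _) => // B _ _; exists B.
rewrite -/p PB.
have := Lset_le0 _ Q_open.1; case QA: (Ldiv_set Q p) => [A| |]// _.
- have SQ := cvg_ln_weight_sum n0_gt0 Q_open QA.
  have SP := cvg_ln_weight_sum n0_gt0 Po PB.
  have SQ0 := weight_sum_gt0_near n0_gt0 Q_open QA.
  have SP0 := weight_sum_gt0_near n0_gt0 Po PB.
  have fE : \forall k \near \oo,
      (((k * n0)%:R^-1)%:E
       * lne (posterior_set (k * n0) (type_equiv k c) Q)%:E)%E =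
      (ln (weight_sum (k * n0) k c Q) / (k * n0)%:R
       - ln (weight_sum (k * n0) k c (pmfs R m)) / (k * n0)%:R)%:E.
    near=> k.
    have k_gt0 : (0 < k)%N by near: k; exact: nbhs_infty_gt.
    have Qk : 0 < weight_sum (k * n0) k c Q by near: k.
    have Pk : 0 < weight_sum (k * n0) k c (pmfs R m) by near: k.
    rewrite posterior_setE ?muln_gt0 ?k_gt0// lne_EFin ?divr_gt0//.
    by rewrite -EFinM ln_div ?posrE// mulrC mulrBl.
  apply: cvg_EFin; first by apply: filterS fE => k ->.
  apply: cvg_trans (cvgB SQ SP); apply: near_eq_cvg.
  by apply: filterS fE => k /= ->.
- apply: cvg_near_cst; near=> k.
  have k_gt0 : (0 < k)%N by near: k; exact: nbhs_infty_gt.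
  have n_gt0 : (0 < k * n0)%N by rewrite muln_gt0 k_gt0.
  rewrite posterior_setE// [weight_sum _ _ _ Q]fsbig1 => [|q [Qq _]].
    by rewrite mul0r le0_lneNy// gt0_muleNy// lte_fin invr_gt0 ltr0n.
  have [q0 _] := Q_open.1 _ Qq.
  have := weight_ge0 c q0; rewrite le_eqVlt => /orP[/eqP<-|w0].
    by rewrite expr0n gtn_eqF.
  have : (Ldiv q p <= -oo)%E by rewrite -QA; apply: ereal_sup_ubound; exists q.
  by rewrite Ldiv_weight_gt0.
Unshelve. all: by end_near. Qed.
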